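(* Let $k$ be a positive integer and consider the $k$-th order system of two rational difference equations $$x_n=\frac{\alpha+\sum^{k}_{i=1}\beta_{i}x_{n-i} + \sum^{k}_{i=1}\gamma_{i}y_{n-i}}{A+\sum^{k}_{j=1}B_{j}x_{n-j} + \sum^{k}_{j=1}C_{j}y_{n-j}},\qquad y_n=\frac{p+\sum^{k}_{i=1}\delta_{i}x_{n-i} + \sum^{k}_{i=1}\epsilon_{i}y_{n-i}}{q+\sum^{k}_{j=1}D_{j}x_{n-j} + \sum^{k}_{j=1}E_{j}y_{n-j}},\qquad n\in\mathbb{N},$$ with non-negative real parameters and non-negative initial conditions. Assume that there exist $M_1>0$ and $M_2\ge 0$ such that every solution satisfies $y_n\le M_1x_n+M_2$ for all $n\in\mathbb{N}$. Assume further that $A=0$, $q=0$, and that at least one of the following holds: (i) $I_B\subseteq I_\beta$, $I_C\subseteq I_\gamma$, $I_B\neq\emptyset$, and $I_D\neq\emptyset$; (ii) $I_D\subseteq I_\delta$, $I_E\subseteq I_\epsilon$, $I_C\neq\emptyset$, and $I_E\neq\emptyset$. Assume moreover that $I_\delta\subseteq I_D$; that there exists a positive integer $\eta_1$ such that for every sequence $\{c_m\}_{m=1}^\infty$ with $c_m\in I_\epsilon$ for all $m\ge 1$ there exist positive integers $N_1,N_2\le\eta_1$ such that $\sum_{m=N_1}^{N_2}c_m\in I_D\cup I_E$; and that there exists a positive integer $\eta_2$ such that for every sequence $\{d_m\}_{m=1}^\infty$ with $d_m\in I_\beta$ for all $m\ge 1$ there exist positive integers $N_3,N_4\le\eta_2$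 such that $\sum_{m=N_3}^{N_4}d_m\in I_B$. Then there exist $M>0$ and $N\in\mathbb{N}$ such that every solution (from any non-negative initial conditions) satisfies $x_n\le M$ and $y_n\le M$ for all $n>N$.
   Context: $\mathbb{N}=\{1,2,\dots\}$. Initial conditions are $x_{1-k},\dots,x_0,y_{1-k},\dots,y_0\ge 0$; a solution is a pair of sequences generated by the system from non-negative initial conditions for which all denominators are positive for every $n\in\mathbb{N}$. For each family of coefficients, the index set is the set of indices in $\{1,\dots,k\}$ with positive coefficient: $I_\beta=\{i:\beta_i>0\}$, $I_\gamma=\{i:\gamma_i>0\}$, $I_\delta=\{i:\delta_i>0\}$, $I_\epsilon=\{i:\epsilon_i>0\}$, $I_B=\{j:B_j>0\}$, $I_C=\{j:C_j>0\}$, $I_D=\{j:D_j>0\}$, $I_E=\{j:E_j>0\}$. A sum whose lower limit exceeds its upper limit is empty and equals $0$. *)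

(* Defs.v *)
From HB Require Import structures.
From mathcomp Require Import all_boot all_order all_algebra.
From mathcomp Require Import reals.

Set Implicit Arguments.
Unset Strict Implicit.
Unset Printing Implicit Defensive.

Import Order.TTheory GRing.Theory Num.Theory.
Local Open Scope ring_scope.

(* Coefficient families are functions [nat -> R] of which only the values at
   1, ..., k are used; sequences are functions [int -> R] of which only the
   values at 1 - k, 2 - k, ... are used. *)

Definition nonneg_coefs (R : realType) (k : nat) (b : nat -> R) : Prop :=
  forall i : nat, (1 <= i <= k)%N -> 0 <= b i.

Definition index_set (R : realType) (k : nat) (b : nat -> R) : pred nat :=
  [pred i | (1 <= i <= k)%N && (0 < b i)].

Definition affine_form (R : realType) (k : nat) (a : R) (b c : nat -> R)
    (x y : int -> R) (n : nat) : R :=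
  a + \sum_(1 <= i < k.+1) b i * x (n%:Z - i%:Z)
    + \sum_(1 <= i < k.+1) c i * y (n%:Z - i%:Z).

Definition is_solution (R : realType) (k : nat)
    (alpha : R) (beta gamma : nat -> R) (A : R) (B C : nat -> R)
    (p : R) (delta epsilon : nat -> R) (q : R) (D E : nat -> R)
    (x y : int -> R) : Prop :=
  (forall m : int, 1 - k%:Z <= m <= 0 -> 0 <= x m /\ 0 <= y m) /\
  (forall n : nat, (1 <= n)%N ->
    [/\ 0 < affine_form k A B C x y n,
        0 < affine_form k q D E x y n,
        x n%:Z = affine_form k alpha beta gamma x y n
                   / affine_form k A B C x y n
      & y n%:Z = affine_form k p delta epsilon x y n
                   / affine_form k q D E x y n]).

(* When N2 < N1 the sum is empty, hence 0, which lies in no index set. *)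
Definition block_sums_meet (I J : pred nat) : Prop :=
  exists eta : nat, (1 <= eta)%N /\
    forall c : nat -> nat, (forall m : nat, (1 <= m)%N -> c m \in I) ->
      exists N1 N2 : nat,
        [/\ (1 <= N1 <= eta)%N, (1 <= N2 <= eta)%N
          & (\sum_(N1 <= m < N2.+1) c m)%N \in J].

(* Main.v *)
Require Import Defs.
From HB Require Import structures.
From mathcomp Require Import all_boot all_order all_algebra.
From mathcomp Require Import boolp reals.
From mathcomp Require Import zify lra.

Set Implicit Arguments.
Unset Strict Implicit.
Unset Printing Implicit Defensive.

Import Order.TTheory GRing.Theory Num.Theory.
Local Open Scope ring_scope.

(* In either case one of the two sequences is bounded below by a positive
   constant, and then so are both denominators from time [k + 1] on.  Since the
   [delta]-terms are absorbed by the [D]-terms, [y n] is at most a constant plus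
   a combination of earlier values of [y] with indices in [I_epsilon], divided
   by the denominator.  Unfolding this along any path of indices, a block sum in
   [I_D] or [I_E] produces a value of [y] divided by a denominator that dominates
   it (through [y <= M1 x + M2] when the index is in [I_D]), so [y] is bounded
   after finitely many steps.  The [gamma]-terms are then bounded, and the same
   argument with [I_beta] and [I_B] bounds [x]. *)

(** * Nonnegative sums and domination between coefficient families *)

Lemma sum_nat_ge0 (R : realType) (k : nat) (F : nat -> R) :
  (forall i, (1 <= i <= k)%N -> 0 <= F i) -> 0 <= \sum_(1 <= i < k.+1) F i.
Proof.
by move=> F0; rewrite big_nat_cond; apply: sumr_ge0 => i /andP[/F0].
Qed.

Lemma le_sum_nat_term (R : realType) (k : nat) (F : nat -> R) (j : nat) :
  (forall i, (1 <= i <= k)%N -> 0 <= F i) -> (1 <= j <= k)%N ->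
  F j <= \sum_(1 <= i < k.+1) F i.
Proof.
move=> F0 jk; rewrite (bigD1_seq j) ?mem_index_iota ?iota_uniq //= lerDl.
rewrite big_nat_cond; apply: sumr_ge0 => i.
by rewrite ltnS => /andP[/F0].
Qed.

Lemma nonneg_coefs_dominated (R : realType) (k : nat) (b c : nat -> R) :
  nonneg_coefs k b -> nonneg_coefs k c ->
  {subset index_set k b <= index_set k c} ->
  exists2 K : R, 0 < K & forall i, (1 <= i <= k)%N -> b i <= K * c i.
Proof.
move=> b0 c0 bc.
have s0 i : (1 <= i <= k)%N -> 0 <= b i / c i.
  by move=> ik; rewrite divr_ge0 ?b0 ?c0.
(* Each ratio is at most the sum of all ratios, and the leading 1 keeps the constant positive. Where
   [c i = 0] also [b i = 0], so the default value of the ratio is harmless. *)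
exists (1 + \sum_(1 <= i < k.+1) b i / c i) => [|i ik].
  by rewrite ltr_pwDl ?sum_nat_ge0.
have := b0 _ ik; rewrite le_eqVlt => /predU1P[<-|bi].
  by rewrite mulr_ge0 ?c0 // addr_ge0 ?sum_nat_ge0.
have /andP[_ ci] : i \in index_set k c by apply: bc; rewrite inE ik.
rewrite -ler_pdivrMr //; apply: le_trans (le_sum_nat_term s0 ik) _.
by rewrite lerDr.
Qed.

(** The indicator of [0 < b i] has the same index set as [b], so a multiple of [b] dominates it. *)
Lemma index_set_lower_bound (R : realType) (k : nat) (b : nat -> R) :
  nonneg_coefs k b ->
  exists2 L : R, 0 < L & forall i, i \in index_set k b -> 1 <= L * b i.
Proof.
move=> b0.
have [|i|L L0 bL] := @nonneg_coefs_dominated R k (fun i => (0 < b i)%R%:R) b _ b0.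
- by move=> i _; exact: ler0n.
- by rewrite !inE ltr0n lt0b.
- by exists L => // i /andP[ik bi]; have := bL i ik; rewrite bi.
Qed.

(** * Estimates for affine forms with nonnegative delayed values *)

Section AffineForm.
Variables (R : realType) (k : nat) (x y : int -> R) (n : nat).
Hypothesis xy0 : forall i, (1 <= i <= k)%N ->
  0 <= x (n%:Z - i%:Z) /\ 0 <= y (n%:Z - i%:Z).

Lemma affine_form_ge0 (a : R) (b c : nat -> R) :
  0 <= a -> nonneg_coefs k b -> nonneg_coefs k c ->
  0 <= affine_form k a b c x y n.
Proof.
move=> a0 b0 c0; rewrite /affine_form !addr_ge0 // sum_nat_ge0 // => i ik;
  have [? ?] := xy0 ik; by rewrite mulr_ge0 ?b0 ?c0.
Qed.

Lemma le_affine_form_x (a : R) (b c : nat -> R) (j : nat) :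
  0 <= a -> nonneg_coefs k b -> nonneg_coefs k c -> (1 <= j <= k)%N ->
  b j * x (n%:Z - j%:Z) <= affine_form k a b c x y n.
Proof.
move=> a0 b0 c0 jk; rewrite /affine_form.
have := @le_sum_nat_term R k (fun i => b i * x (n%:Z - i%:Z)) j.
have : 0 <= \sum_(1 <= i < k.+1) c i * y (n%:Z - i%:Z).
  by apply: sum_nat_ge0 => i ik; have [? ?] := xy0 ik; rewrite mulr_ge0 ?c0.
move=> s0 /(_ _ jk) H; apply: le_trans (H _) _.
  by move=> i ik; have [? ?] := xy0 ik; rewrite mulr_ge0 ?b0.
lra.
Qed.

Lemma le_affine_form_y (a : R) (b c : nat -> R) (j : nat) :
  0 <= a -> nonneg_coefs k b -> nonneg_coefs k c -> (1 <= j <= k)%N ->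
  c j * y (n%:Z - j%:Z) <= affine_form k a b c x y n.
Proof.
move=> a0 b0 c0 jk; rewrite /affine_form.
have := @le_sum_nat_term R k (fun i => c i * y (n%:Z - i%:Z)) j.
have : 0 <= \sum_(1 <= i < k.+1) b i * x (n%:Z - i%:Z).
  by apply: sum_nat_ge0 => i ik; have [? ?] := xy0 ik; rewrite mulr_ge0 ?b0.
move=> s0 /(_ _ jk) H; apply: le_trans (H _) _.
  by move=> i ik; have [? ?] := xy0 ik; rewrite mulr_ge0 ?c0.
lra.
Qed.

Lemma le_affine_form (a K : R) (b c b' c' : nat -> R) :
  0 <= K * a ->
  (forall i, (1 <= i <= k)%N -> b i <= K * b' i) ->
  (forall i, (1 <= i <= k)%N -> c i <= K * c' i) ->
  affine_form k 0 b c x y n <= K * affine_form k a b' c' x y n.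
Proof.
move=> Ka bb' cc'; rewrite /affine_form add0r !mulrDr !mulr_sumr.
apply: lerD; last first.
  apply: ler_sum_nat => i ik; have [? ?] := xy0 ik.
  by rewrite mulrA ler_wpM2r ?cc'.
rewrite -[leLHS]add0r lerD //.
apply: ler_sum_nat => i ik; have [? ?] := xy0 ik.
by rewrite mulrA ler_wpM2r ?bb'.
Qed.

End AffineForm.

(** * Backward paths of delays *)

Section BackwardOrbit.
Variables (k N0 eta n : nat) (f : nat -> nat).
Hypotheses (fk : forall s, (1 <= f s <= k)%N) (kN0 : (k <= N0)%N).
Hypothesis nN : (N0 + k * eta < n)%N.

Let orbit m := iter m (fun s => s - f s)%N n.

Lemma backward_orbit_gt m : (m <= eta)%N -> (N0 < orbit m)%N.
Proof.
have tlow : (n <= orbit m + k * m)%N.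
  elim: m => [|m IH]; first by rewrite muln0 addn0.
  have -> : orbit m.+1 = (orbit m - f (orbit m))%N by [].
  by have := fk (orbit m); rewrite mulnS; lia.
by move=> me; have : (k * m <= k * eta)%N; [rewrite leq_mul2l me orbT|lia].
Qed.

(** The steps telescope: through step [eta] the path stays above [N0 >= k], so no subtraction is
    truncated. *)
Lemma sum_backward_orbit i j : (i + j <= eta)%N ->
  ((\sum_(i <= m < i + j) f (orbit m)) + orbit (i + j) = orbit i)%N.
Proof.
elim: j => [|j IH] ij; first by rewrite addn0 big_geq.
have Nij : (N0 < orbit (i + j))%N by apply: backward_orbit_gt; lia.
rewrite -IH; last by lia.
have oS : orbit (i + j).+1 = (orbit (i + j) - f (orbit (i + j)))%N by [].
rewrite addnS oS big_nat_recr ?leq_addr //=.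
by have := fk (orbit (i + j)); lia.
Qed.

(** Since 0 is not in [J], a block with sum in [J] is nonempty; the length [j.+1] sets its first
    step apart from the other [j]. Blocks count from 1 and path times from 0, hence [m.-1]. *)
Lemma backward_orbit_block (J : pred nat) N1 N2 :
  0%N \notin J -> (1 <= N1 <= eta)%N -> (1 <= N2 <= eta)%N ->
  (\sum_(N1 <= m < N2.+1) f (orbit m.-1))%N \in J ->
  exists i j d, [/\ (i + j.+1 <= eta)%N, d \in J
    & orbit (i + j.+1) = (orbit i - d)%N].
Proof.
move=> J0 N1e N2e sJ.
have N12 : (N1 <= N2)%N.
  by rewrite leqNgt; apply: contraNN J0 => N21; rewrite big_geq in sJ.
case: N1 N1e N12 sJ => // i ie iN2 sJ.
exists i, (N2 - i.+1)%N, (\sum_(i.+1 <= m < N2.+1) f (orbit m.-1))%N.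
have N2E : (i + (N2 - i.+1).+1)%N = N2 by lia.
split => //; first by lia.
rewrite big_add1 /= N2E; have := @sum_backward_orbit i (N2 - i.+1).+1.
rewrite N2E => /(_ _) <-; last by lia.
by rewrite addKn.
Qed.

End BackwardOrbit.

(** * Boundedness from block sums *)

Lemma geometric_bound (R : realType) (w : nat -> R) (P : R) (eta i j : nat) :
  0 <= P -> (forall m, (m < eta)%N -> w m <= P * w m.+1) ->
  (i + j <= eta)%N -> w i <= P ^+ j * w (i + j)%N.
Proof.
move=> P0 wP; elim: j i => [|j IH] i ij; first by rewrite addn0 mul1r.
apply: le_trans (wP i _) _; first by lia.
by rewrite exprS -mulrA ler_wpM2l // -addSnnS IH // addSnnS.
Qed.

(* Following at each time the largest delayed term gives a path in the index
   set of [b]; two of its times differ by an element of [J], so the term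
   reached at the later step is absorbed by [den] at the earlier one, while all
   other factors [1 / den] are at most [1 / a]. *)
Lemma bounded_of_block_sums_meet (R : realType) (k N0 : nat) (b : nat -> R)
    (J : pred nat) (K a L : R) :
  (k <= N0)%N -> nonneg_coefs k b -> 0%N \notin J ->
  0 <= K -> 0 < a -> 0 <= L ->
  block_sums_meet (index_set k b) J ->
  exists (M : R) (N : nat), forall z den : nat -> R,
    (forall n, (0 < n)%N -> 0 <= z n) ->
    (forall n, (N0 < n)%N -> a <= den n) ->
    (forall n, (N0 < n)%N ->
       z n <= K + (\sum_(1 <= i < k.+1) b i * z (n - i)%N) / den n) ->
    (forall n j, (N0 < n)%N -> j \in J -> z (n - j)%N <= L * den n) ->
    forall n, (N < n)%N -> z n <= M.
Proof.
move=> kN0 b0 J0 K0 a0 L0 [eta [eta0 blk]].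
pose S := \sum_(1 <= i < k.+1) b i.
have S0 : 0 <= S by apply: sum_nat_ge0.
(* [P] bounds the growth of [1 + z] over one step; the added 1 absorbs the constant [K]. *)
pose P := 1 + K + S / a.
have Sa0 : 0 <= S / a by rewrite divr_ge0 // ltW.
have P1 : 1 <= P by rewrite /P; lra.
have P0 : 0 <= P by lra.
(* [W] will bound [1 + z] at the time where a block with sum in [J] starts. *)
pose W := 1 + K + S * (P ^+ eta * (a^-1 + L)).
have W0 : 0 <= W.
  have ? : 0 <= S * (P ^+ eta * (a^-1 + L)).
    by rewrite !mulr_ge0 ?exprn_ge0 // addr_ge0 // invr_ge0 ltW.
  by rewrite /W; lra.
(* The summand [K] covers an empty index set, where no path exists; [k * eta] leaves room for [eta]
   backward steps beyond [N0]. *)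
exists (K + P ^+ eta * W), (N0 + k * eta)%N => z den z0 dena rec absorb n nN.
have [[i0 i0I]|noI] := pselect (exists i, i \in index_set k b); last first.
  have bz i : (1 <= i <= k)%N -> b i = 0.
    move=> ik; apply: contra_notP noI => bi; exists i; rewrite inE ik /=.
    by rewrite lt_neqAle b0 // andbT eq_sym; apply/eqP.
  have nN0 : (N0 < n)%N by apply: leq_ltn_trans nN; exact: leq_addr.
  apply: le_trans (rec _ nN0) _; rewrite lerD2l big_nat_cond big1.
    by rewrite mul0r mulr_ge0 ?exprn_ge0.
  by move=> i /andP[ik _]; rewrite bz ?mul0r.
have /choice[f fP] : forall t, exists i, i \in index_set k b /\
    forall j, j \in index_set k b -> z (t - j)%N <= z (t - i)%N.
  move=> t; have i0k : (i0 < k.+1)%N by case/andP: i0I => /andP[].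
  pose o0 := Ordinal i0k.
  have := @Order.TotalTheory.arg_maxP _ _ _ o0
    (fun i : 'I_k.+1 => nat_of_ord i \in index_set k b)
    (fun i : 'I_k.+1 => z (t - i)%N) i0I.
  case=> i iI imax; exists i; split => // j jI.
  have jk : (j < k.+1)%N by case/andP: jI => /andP[].
  exact: (imax (Ordinal jk)).
have fk t : (1 <= f t <= k)%N by have [/andP[]] := fP t.
have step t : (N0 < t)%N -> z t <= K + S * z (t - f t)%N / den t.
  move=> tN; apply: le_trans (rec t tN) _; rewrite lerD2l ler_wpM2r //.
    by rewrite invr_ge0 (le_trans (ltW a0)) ?dena.
  rewrite mulr_suml; apply: ler_sum_nat => i ik.
  have := b0 i ik; rewrite le_eqVlt => /predU1P[<-|bi]; first by rewrite !mul0r.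
  by rewrite ler_pM2l // (fP t).2 // inE ik.
pose t m := iter m (fun s => s - f s)%N n.
have tS m : t m.+1 = (t m - f (t m))%N by [].
have tN0 m : (m <= eta)%N -> (N0 < t m)%N by exact: backward_orbit_gt fk kN0 nN m.
have tz m : (m <= eta)%N -> 0 <= z (t m).
  by move=> /tN0 tm; apply: z0; apply: leq_ltn_trans tm.
have growth m : (m < eta)%N -> 1 + z (t m) <= P * (1 + z (t m.+1)).
  move=> me; have tm := tN0 _ (ltnW me); have zS := tz _ me.
  have : S * z (t m.+1) / den (t m) <= S / a * z (t m.+1).
    rewrite mulrAC ler_wpM2r // ler_wpM2l // lef_pV2 ?posrE ?dena //.
    by rewrite (lt_le_trans a0) ?dena.
  have := step _ tm; rewrite -tS /P.
  have : 0 <= K * z (t m.+1) by rewrite mulr_ge0.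
  by rewrite mulrDr mulr1 !mulrDl mul1r; lra.
have [m _|N1 [N2 [N1e N2e sJ]]] := blk (fun m => f (t m.-1)).
  by have [] := fP (t m.-1).
have [i [j [d [ije dJ tE]]]] := backward_orbit_block fk kN0 nN J0 N1e N2e sJ.
rewrite -/(t _) -/(t i) in tE.
have ie : (i < eta)%N by apply: leq_trans ije; rewrite addnS ltnS leq_addr.
have je : (j <= eta)%N.
  by apply: leq_trans (leq_trans (leqnSn j) _) ije; exact: leq_addl.
have tiN := tN0 _ (ltnW ie).
have d0 : 0 < den (t i) by rewrite (lt_le_trans a0) ?dena.
have zabs : z (t (i + j.+1)%N) <= L * den (t i) by rewrite tE absorb.
have Pe m : (m <= eta)%N -> P ^+ m <= P ^+ eta by move=> ?; apply: ler_weXn2l.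
(* The first step of the block keeps the divisor [den (t i)]. The other [j] steps cost [P ^+ j] and
   end at a value at most [L * den (t i)], so this denominator cancels. *)
have zi : 1 + z (t i) <= W.
  have g : 1 + z (t i.+1) <= P ^+ j * (1 + z (t (i + j.+1)%N)).
    by rewrite -addSnnS; apply: geometric_bound growth _; rewrite // addSnnS.
  have ad : 1 <= a^-1 * den (t i).
    by rewrite -(mulVf (lt0r_neq0 a0)) ler_wpM2l ?dena // invr_ge0 ltW.
  have zS : z (t i.+1) <= P ^+ eta * (a^-1 + L) * den (t i).
    apply: (@le_trans _ _ (1 + z (t i.+1))); first by rewrite lerDr.
    apply: le_trans g _; rewrite -mulrA ler_pM ?exprn_ge0 ?Pe //.
    - by rewrite addr_ge0 ?tz.
    - by rewrite mulrDl lerD.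
  have : S * z (t i.+1) / den (t i) <= S * (P ^+ eta * (a^-1 + L)).
    by rewrite ler_pdivrMr // -mulrA ler_wpM2l.
  by have := step _ tiN; rewrite -tS /W; lra.
(* The [i] steps from [n] to the start of the block cost at most another [P ^+ eta]. *)
have : 1 + z n <= P ^+ eta * W.
  have /le_trans := geometric_bound P0 growth (i := 0) (j := i) (ltnW ie).
  apply; rewrite add0n ler_pM ?exprn_ge0 ?Pe // ?(ltnW ie) //.
  by rewrite addr_ge0 ?tz // ltnW.
lra.
Qed.

(** * Lower bounds for quotients and denominators *)

(** Termwise, the denominator is at most [K1 + K2] times the numerator; its constant term is 0, so
    this works even for [u = 0]. The bound depends on the coefficients only. *)
Lemma affine_quotient_bounded_below (R : realType) (k : nat) (u : R)
    (b c b' c' : nat -> R) :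
  0 <= u -> nonneg_coefs k b -> nonneg_coefs k c ->
  nonneg_coefs k b' -> nonneg_coefs k c' ->
  {subset index_set k b' <= index_set k b} ->
  {subset index_set k c' <= index_set k c} ->
  exists2 m : R, 0 < m & forall (x y : int -> R) (n : nat),
    (forall i, (1 <= i <= k)%N ->
       0 <= x (n%:Z - i%:Z) /\ 0 <= y (n%:Z - i%:Z)) ->
    0 < affine_form k 0 b' c' x y n ->
    m <= affine_form k u b c x y n / affine_form k 0 b' c' x y n.
Proof.
move=> u0 b0 c0 b'0 c'0 sb sc.
have [K1 K10 h1] := nonneg_coefs_dominated b'0 b0 sb.
have [K2 K20 h2] := nonneg_coefs_dominated c'0 c0 sc.
have K0 : 0 < K1 + K2 by rewrite addr_gt0.
exists (K1 + K2)^-1 => [|x y n xy0 d0]; first by rewrite invr_gt0.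
rewrite ler_pdivlMr // mulrC ler_pdivrMr // mulrC.
apply: le_affine_form => // [|i ik|i ik]; first by rewrite mulr_ge0 // ltW.
- by rewrite (le_trans (h1 i ik)) // ler_wpM2r ?b0 // lerDl ltW.
- by rewrite (le_trans (h2 i ik)) // ler_wpM2r ?c0 // lerDr ltW.
Qed.

Lemma is_solution_ge0 (R : realType) (k : nat)
    (alpha A p q : R) (beta gamma B C delta epsilon D E : nat -> R)
    (x y : int -> R) :
  0 <= alpha -> 0 <= p -> nonneg_coefs k beta -> nonneg_coefs k gamma ->
  nonneg_coefs k delta -> nonneg_coefs k epsilon ->
  is_solution k alpha beta gamma A B C p delta epsilon q D E x y ->
  forall m : int, 1 - k%:Z <= m -> 0 <= x m /\ 0 <= y m.
Proof.
move=> alpha0 p0 beta0 gamma0 delta0 epsilon0 [init rec].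
(* Delays reach back up to [k] steps, so the induction carries all times up to [n]. *)
suff H n (m : int) : 1 - k%:Z <= m <= n%:Z -> 0 <= x m /\ 0 <= y m.
  by move=> m km; apply: (H `|m|%N); lia.
elim: n m => [//|n IH] m mn.
have [mn'|nm] := boolP (m <= n%:Z); first by apply: IH; lia.
have -> : m = n.+1%:Z by lia.
have xy0 i : (1 <= i <= k)%N ->
    0 <= x (n.+1%:Z - i%:Z) /\ 0 <= y (n.+1%:Z - i%:Z).
  by move=> ik; apply: IH; lia.
have [dx dy -> ->] := rec n.+1 isT.
by split; apply: divr_ge0; rewrite ?(ltW dx) ?(ltW dy) ?affine_form_ge0.
Qed.

Lemma is_solution_delayed_ge0 (R : realType) (k : nat)
    (alpha A p q : R) (beta gamma B C delta epsilon D E : nat -> R)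
    (x y : int -> R) (n i : nat) :
  0 <= alpha -> 0 <= p -> nonneg_coefs k beta -> nonneg_coefs k gamma ->
  nonneg_coefs k delta -> nonneg_coefs k epsilon ->
  is_solution k alpha beta gamma A B C p delta epsilon q D E x y ->
  (0 < n)%N -> (1 <= i <= k)%N ->
  0 <= x (n%:Z - i%:Z) /\ 0 <= y (n%:Z - i%:Z).
Proof.
move=> alpha0 p0 beta0 gamma0 delta0 epsilon0 sol n0 ik.
apply: (is_solution_ge0 alpha0 p0 beta0 gamma0 delta0 epsilon0 sol).
by clear -n0 ik; lia.
Qed.

(** Passes from the integer times of the system to the natural times of the boundedness lemma. *)
Lemma subz_delay (k n i : nat) : (k < n)%N -> (1 <= i <= k)%N ->
  n%:Z - i%:Z = (n - i)%N%:Z.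
Proof. lia. Qed.

(* A numerator that dominates its denominator keeps the quotient away from 0,
   and that quotient occurs in both denominators. *)
Lemma denominators_bounded_below (R : realType) (k : nat)
    (alpha p : R) (beta gamma B C delta epsilon D E : nat -> R) :
  0 <= alpha -> 0 <= p ->
  nonneg_coefs k beta -> nonneg_coefs k gamma ->
  nonneg_coefs k B -> nonneg_coefs k C ->
  nonneg_coefs k delta -> nonneg_coefs k epsilon ->
  nonneg_coefs k D -> nonneg_coefs k E ->
  [/\ {subset index_set k B <= index_set k beta},
      {subset index_set k C <= index_set k gamma},
      exists i, i \in index_set k B
    & exists i, i \in index_set k D]
  \/
  [/\ {subset index_set k D <= index_set k delta},
      {subset index_set k E <= index_set k epsilon},
      exists i, i \in index_set k C
    & exists i, i \in index_set k E] ->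
  exists2 a : R, 0 < a & forall x y : int -> R,
    is_solution k alpha beta gamma 0 B C p delta epsilon 0 D E x y ->
    forall n : nat, (k < n)%N ->
      a <= affine_form k 0 B C x y n /\ a <= affine_form k 0 D E x y n.
Proof.
move=> alpha0 p0 beta0 gamma0 B0 C0 delta0 epsilon0 D0 E0.
have win x y (n i : nat) :
    is_solution k alpha beta gamma 0 B C p delta epsilon 0 D E x y ->
    (0 < n)%N -> (1 <= i <= k)%N ->
    0 <= x (n%:Z - i%:Z) /\ 0 <= y (n%:Z - i%:Z).
  exact: is_solution_delayed_ge0.
case=> [] [sub1 sub2 [i /andP[ik bi]] [j /andP[jk dj]]].
- have [m m0 hm] :=
    affine_quotient_bounded_below alpha0 beta0 gamma0 B0 C0 sub1 sub2.
  exists (Num.min (B i * m) (D j * m)) => [|x y sol n kn].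
    by rewrite lt_min !mulr_gt0.
  (* As [n > k], every delayed time is positive, so the recursion governs the value there. *)
  have xm (l : nat) : (1 <= l <= k)%N -> m <= x (n%:Z - l%:Z).
    move=> lk; rewrite (subz_delay kn lk).
    have nl : (0 < n - l)%N.
      by case/andP: lk => _ lk; rewrite subn_gt0 (leq_ltn_trans lk).
    by have [dx _ -> _] := sol.2 _ nl; apply: hm => // r; apply: win.
  have w r : (1 <= r <= k)%N -> _ := win x y n r sol (leq_ltn_trans (leq0n k) kn).
  split; rewrite ge_min; apply/orP; [left|right].
  + by apply: le_trans (le_affine_form_x w _ _ _ ik) => //; rewrite ler_pM2l ?xm.
  + by apply: le_trans (le_affine_form_x w _ _ _ jk) => //; rewrite ler_pM2l ?xm.
(* The same argument for [y], which enters the denominators through [C i] and [E j]. *)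
- have [m m0 hm] :=
    affine_quotient_bounded_below p0 delta0 epsilon0 D0 E0 sub1 sub2.
  exists (Num.min (C i * m) (E j * m)) => [|x y sol n kn].
    by rewrite lt_min !mulr_gt0.
  have ym (l : nat) : (1 <= l <= k)%N -> m <= y (n%:Z - l%:Z).
    move=> lk; rewrite (subz_delay kn lk).
    have nl : (0 < n - l)%N.
      by case/andP: lk => _ lk; rewrite subn_gt0 (leq_ltn_trans lk).
    by have [_ dy _ ->] := sol.2 _ nl; apply: hm => // r; apply: win.
  have w r : (1 <= r <= k)%N -> _ := win x y n r sol (leq_ltn_trans (leq0n k) kn).
  split; rewrite ge_min; apply/orP; [left|right].
  + by apply: le_trans (le_affine_form_y w _ _ _ ik) => //; rewrite ler_pM2l ?ym.
  + by apply: le_trans (le_affine_form_y w _ _ _ jk) => //; rewrite ler_pM2l ?ym.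
Qed.

(** * Uniform bounds for [y], then for [x] *)

Theorem theorem19 (R : realType) (k : nat) (hk : (1 <= k)%N)
    (alpha A p q : R) (beta gamma B C delta epsilon D E : nat -> R)
    (halpha : 0 <= alpha) (hA0 : 0 <= A) (hp : 0 <= p) (hq0 : 0 <= q)
    (hbeta : nonneg_coefs k beta) (hgamma : nonneg_coefs k gamma)
    (hB : nonneg_coefs k B) (hC : nonneg_coefs k C)
    (hdelta : nonneg_coefs k delta) (hepsilon : nonneg_coefs k epsilon)
    (hD : nonneg_coefs k D) (hE : nonneg_coefs k E)
    (hyx : exists M1 M2 : R, [/\ 0 < M1, 0 <= M2
      & forall x y : int -> R,
          is_solution k alpha beta gamma A B C p delta epsilon q D E x y ->
          forall n : nat, (1 <= n)%N -> y n%:Z <= M1 * x n%:Z + M2])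
    (hA : A = 0) (hq : q = 0)
    (hcases :
      [/\ {subset index_set k B <= index_set k beta},
          {subset index_set k C <= index_set k gamma},
          exists i, i \in index_set k B
        & exists i, i \in index_set k D]
      \/
      [/\ {subset index_set k D <= index_set k delta},
          {subset index_set k E <= index_set k epsilon},
          exists i, i \in index_set k C
        & exists i, i \in index_set k E])
    (hdeltaD : {subset index_set k delta <= index_set k D})
    (hepsilonDE : block_sums_meet (index_set k epsilon)
                    [predU index_set k D & index_set k E])
    (hbetaB : block_sums_meet (index_set k beta) (index_set k B)) :
  exists (M : R) (N : nat), [/\ 0 < M, (1 <= N)%N
    & forall x y : int -> R,
        is_solution k alpha beta gamma A B C p delta epsilon q D E x y ->
        forall n : nat, (N < n)%N -> x n%:Z <= M /\ y n%:Z <= M].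
Proof.
subst A q; have [M1 [M2 [M10 M20 yx]]] := hyx.
have [a a0 ha] := denominators_bounded_below halpha hp hbeta hgamma hB hC
  hdelta hepsilon hD hE hcases.
have [Kd Kd0 dD] := nonneg_coefs_dominated hdelta hD hdeltaD.
have [LB LB0 hLB] := index_set_lower_bound hB.
have [LD LD0 hLD] := index_set_lower_bound hD.
have [LE LE0 hLE] := index_set_lower_bound hE.
have absorb (b L d v : R) : 0 < L -> 0 <= v -> 1 <= L * b -> b * v <= d ->
    v <= L * d.
  move=> L0 v0 Lb bv; apply: (@le_trans _ _ (L * b * v)); first by rewrite ler_peMl.
  by rewrite -mulrA ler_pM2l.
(* [LE] serves delays in [I_E]; [M1 * LD + M2 / a] serves those in [I_D], through
   [y <= M1 x + M2]. *)
have Ly0 : 0 <= LE + (M1 * LD + M2 / a).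
  by rewrite !addr_ge0 ?mulr_ge0 ?invr_ge0 // ltW.
(* In [K], [p / a] comes from the constant term and [Kd] from the [delta]-terms. No solution is
   fixed yet, so the bound is uniform. *)
have [||MY [NY hY]] := bounded_of_block_sums_meet (leqnn k) hepsilon _ _ a0 Ly0
    hepsilonDE (K := p / a + Kd).
- by rewrite !inE.
- by rewrite addr_ge0 ?divr_ge0 // ltW.
pose G := \sum_(1 <= i < k.+1) gamma i.
(* The sign of [MY] is unknown; the absolute value makes the constant for [x] nonnegative. *)
pose Y := `|MY|.
have G0 : 0 <= G by apply: sum_nat_ge0.
(* Starting beyond [k + NY] keeps all delayed times beyond [NY], where [y] is bounded. *)
have kN : (k <= k + NY)%N by exact: leq_addr.
have [||MX [NX hX]] := bounded_of_block_sums_meet kN hbeta _ _ a0 (ltW LB0)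
    hbetaB (K := (alpha + G * Y) / a).
- by rewrite !inE.
- by rewrite divr_ge0 ?(ltW a0) // addr_ge0 // mulr_ge0 // normr_ge0.
exists (1 + `|MX| + `|MY|), (NX + NY).+1; split => //.
  by rewrite ltr_wpDr ?ltr_pwDl.
move=> x y sol.
have pos n : (0 < n)%N -> 0 <= x n%:Z /\ 0 <= y n%:Z.
  move=> n0; apply: (is_solution_ge0 halpha hp hbeta hgamma hdelta hepsilon sol).
  by clear -n0; lia.
have win (n i : nat) : (0 < n)%N -> (1 <= i <= k)%N ->
    0 <= x (n%:Z - i%:Z) /\ 0 <= y (n%:Z - i%:Z).
  exact: (is_solution_delayed_ge0 halpha hp hbeta hgamma hdelta hepsilon sol).
have sumZ (f : nat -> R) (z : int -> R) (n : nat) : (k < n)%N ->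
    \sum_(1 <= i < k.+1) f i * z (n%:Z - i%:Z)
    = \sum_(1 <= i < k.+1) f i * z (n - i)%N%:Z.
  by move=> kn; apply: eq_big_nat => i ik; rewrite (subz_delay kn ik).
have yM (n : nat) : (NY < n)%N -> y n%:Z <= MY.
  move: n; apply: (hY (fun n => y n%:Z) (fun n => affine_form k 0 D E x y n)).
  - by move=> n n0; have [] := pos n n0.
  - by move=> n /(ha x y sol n)[].
  - move=> n kn; have n0 : (0 < n)%N by exact: leq_ltn_trans kn.
    have [_ d0 _ ->] := sol.2 n n0; have [_ ad] := ha x y sol n kn.
    rewrite -(sumZ epsilon y) // {1}/affine_form !mulrDl lerD2r lerD //.
      by rewrite ler_wpM2l // lef_pV2 ?posrE.
    rewrite ler_pdivrMr //.
    (* Zero [y]-coefficients turn the [delta]-sum into an affine form, which can be compared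
       termwise with the denominator. *)
    apply: (@le_trans _ _ (affine_form k 0 delta (fun=> 0) x y n)).
      rewrite /affine_form add0r lerDl big1 // => i _.
      by rewrite mul0r.
    apply: (le_affine_form (fun i => @win n i n0)) => [||i ik] //.
    + by rewrite mulr0.
    + by rewrite mulr_ge0 ?hE // ltW.
  - move=> n j kn jJ; have n0 : (0 < n)%N by exact: leq_ltn_trans kn.
    have jk : (1 <= j <= k)%N by move: jJ; rewrite !inE => /orP[] /andP[].
    have [_ ad] := ha x y sol n kn.
    have [x0 y0] := win n j n0 jk.
    (* The comparison of [y] with [x] is available only at positive times. *)
    have nj : (1 <= n - j)%N.
      by case/andP: jk => _ jk; rewrite subn_gt0 (leq_ltn_trans jk).
    have w i := @win n i n0.
    set d := affine_form k 0 D E x y n in ad *.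
    have d0 : 0 <= d by rewrite (le_trans (ltW a0)).
    move: jJ; rewrite -(subz_delay kn jk) !inE => /orP[] /andP[_ cj].
    + have xd : x (n%:Z - j%:Z) <= LD * d.
        apply: absorb (hLD j _) _ => //; first by rewrite inE jk.
        exact: le_affine_form_x.
      have := yx x y sol _ nj; rewrite -(subz_delay kn jk) => /le_trans; apply.
      (* The constant [M2] is absorbed because [a <= d]. *)
      have : M2 <= M2 / a * d.
        by rewrite -mulrA ler_peMr // mulrC ler_pdivlMr // mul1r.
      have : M1 * x (n%:Z - j%:Z) <= M1 * (LD * d) by rewrite ler_pM2l.
      have : 0 <= LE * d by rewrite mulr_ge0 // ltW.
      by rewrite !mulrDl mulrA; lra.
    + apply: (@le_trans _ _ (LE * d)).
        apply: absorb (hLE j _) _ => //; first by rewrite inE jk.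
        exact: le_affine_form_y.
      by rewrite mulrDl lerDl mulr_ge0 // addr_ge0 ?mulr_ge0 ?invr_ge0 // ltW.
have xM (n : nat) : (NX < n)%N -> x n%:Z <= MX.
  move: n; apply: (hX (fun n => x n%:Z) (fun n => affine_form k 0 B C x y n)).
  - by move=> n n0; have [] := pos n n0.
  - by move=> n kn; have [|//] := ha x y sol n; apply: leq_ltn_trans kn.
  - move=> n kn; have n0 : (0 < n)%N by exact: leq_ltn_trans kn.
    have kn' : (k < n)%N by apply: leq_ltn_trans kn.
    have [d0 _ -> _] := sol.2 n n0; have [ad _] := ha x y sol n kn'.
    (* The [gamma]-sum joins [alpha] in the constant part, leaving the [beta]-sum for the
       recursion. *)
    rewrite -(sumZ beta x) // {1}/affine_form addrAC mulrDl lerD2r.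
    apply: (@le_trans _ _ ((alpha + G * Y) / affine_form k 0 B C x y n)); last first.
      by rewrite ler_wpM2l ?lef_pV2 ?posrE // addr_ge0 // mulr_ge0 // normr_ge0.
    rewrite ler_pM2r ?invr_gt0 // lerD2l /G mulr_suml.
    apply: ler_sum_nat => i ik; rewrite ler_wpM2l ?hgamma // (subz_delay kn' ik).
    apply: le_trans (yM _ _) (ler_norm _).
    by clear -kn ik; lia.
  - move=> n j kn jJ; have n0 : (0 < n)%N by exact: leq_ltn_trans kn.
    have kn' : (k < n)%N by apply: leq_ltn_trans kn.
    have /andP[jk _] := jJ; have [x0 _] := win n j n0 jk.
    rewrite -(subz_delay kn' jk); apply: absorb (hLB j jJ) _ => //.
    by apply: (le_affine_form_x (fun i => @win n i n0)).
move=> n nN; have ? := ler_norm MX; have ? := ler_norm MY.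
have ? := normr_ge0 MX; have ? := normr_ge0 MY.
have ? : y n%:Z <= MY by apply: yM; clear -nN; lia.
have ? : x n%:Z <= MX by apply: xM; clear -nN; lia.
by split; lra.
Qed.
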